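(* Let $G\subset\mathrm{O}(n)$ be a closed subgroup that operates transitively on the unit sphere in $\mathbb{R}^n$. If $\mu\in\mathrm{VConv}_1(\mathbb{R}^n)$ is a continuous valuation that is in addition $G$-invariant, then $\mu$ is $\mathrm{O}(n)$-invariant.
   Context: $\mathrm{Conv}(\mathbb{R}^n,\mathbb{R})$ is the set of all convex functions $f:\mathbb{R}^n\to\mathbb{R}$, with the topology of uniform convergence on compact subsets. A functional $\mu:\mathrm{Conv}(\mathbb{R}^n,\mathbb{R})\to\mathbb{R}$ is a valuation if $\mu(f\vee h)+\mu(f\wedge h)=\mu(f)+\mu(h)$ for all $f,h$ such that the pointwise maximum $f\vee h$ and minimum $f\wedge h$ belong to $\mathrm{Conv}(\mathbb{R}^n,\mathbb{R})$. $\mathrm{VConv}(\mathbb{R}^n)$ is the space of all continuous valuations $\mu$ on $\mathrm{Conv}(\mathbb{R}^n,\mathbb{R})$ that are dually epi-translation invariant, i.e. $\mu(f+\lambda+c)=\mu(f)$ for all $f$, all linear functionals $\lambda$ and all $c\in\mathbb{R}$. $\mathrm{VConv}_1(\mathbb{R}^n)$ is the subspace of $1$-homogeneous valuations: $\mu(tf)=t\mu(f)$ for all $t\ge 0$ and all $f$. For a subgroup $G\subset\mathrm{GL}(n,\mathbb{R})$, $\mu$ is $G$-invariant if $\mu(f\circ g)=\mu(f)$ for all $f$ and all $g\in G$. *)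

(* Defs.v *)
From mathcomp Require Import all_boot all_order all_algebra.
From mathcomp Require Import all_classical all_reals all_analysis.

Set Implicit Arguments.
Unset Strict Implicit.
Unset Printing Implicit Defensive.

Import Order.TTheory GRing.Theory Num.Theory.
Import numFieldNormedType.Exports.

Local Open Scope classical_set_scope.
Local Open Scope ring_scope.

(* All functions R^n -> R with the topology of uniform convergence on compact
   sets; [Conv] below carries the subspace topology. *)
Notation funspace R n := {family compact, 'cV[R]_n -> R}.

Section ConvexValuations.
Variables (R : realType) (n : nat).

Definition Conv : set (funspace R n) :=
  [set f : funspace R n | convex_function setT f].

(* A functional on [Conv] is represented by a function on [funspace] whose
   values outside [Conv] are irrelevant: every condition below, continuity
   included, only involves its restriction to [Conv]. *)
Implicit Type mu : funspace R n -> R.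

Definition valuation mu : Prop :=
  forall f h : funspace R n, Conv f -> Conv h ->
    Conv (fun x => Num.max (f x) (h x)) ->
    Conv (fun x => Num.min (f x) (h x)) ->
    mu (fun x => Num.max (f x) (h x)) + mu (fun x => Num.min (f x) (h x)) =
    mu f + mu h.

Definition dually_epi_translation_invariant mu : Prop :=
  forall (f : funspace R n) (lambda : {scalar 'cV[R]_n}) (c : R), Conv f ->
    mu (fun x => f x + lambda x + c) = mu f.

Definition VConv : set (funspace R n -> R) :=
  [set mu : funspace R n -> R |
    [/\ {within Conv, continuous mu}, valuation mu
      & dually_epi_translation_invariant mu]].

Definition homogeneous1 mu : Prop :=
  forall (t : R) (f : funspace R n), 0 <= t -> Conv f ->
    mu (fun x => t * f x) = t * mu f.

Definition VConv1 : set (funspace R n -> R) :=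
  [set mu : funspace R n -> R | VConv mu /\ homogeneous1 mu].

Definition invariant_under (G : set 'M[R]_n) mu : Prop :=
  forall (f : funspace R n) (g : 'M[R]_n), Conv f -> G g ->
    mu (fun x => f (g *m x)) = mu f.

Definition subgroup_GL (G : set 'M[R]_n) : Prop :=
  [/\ G `<=` [set g | g \in unitmx],
      G 1%:M,
      forall g h, G g -> G h -> G (g *m h)
    & forall g, G g -> G (invmx g)].

Definition orthogonal_group : set 'M[R]_n := [set g | g *m g^T = 1%:M].

(* The library norm on matrices is the sup norm, hence an explicit Euclidean
   norm. *)
Definition euclidean_norm (x : 'cV[R]_n) : R :=
  Num.sqrt (\sum_(i < n) x i 0 ^+ 2).

Definition unit_sphere : set 'cV[R]_n := [set x | euclidean_norm x = 1].

Definition transitive_on_sphere (G : set 'M[R]_n) : Prop :=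
  forall u v, unit_sphere u -> unit_sphere v -> exists2 g, G g & g *m u = v.

End ConvexValuations.

Arguments Conv R n _ : clear implicits.
Arguments VConv R n _ : clear implicits.
Arguments VConv1 R n _ : clear implicits.
Arguments orthogonal_group R n _ : clear implicits.
Arguments unit_sphere R n _ : clear implicits.

(* Main.v *)
(* The mean over [G] of a convex [f] is constant on spheres, as [G] is transitive
   on them, and so is the mean over [G] of [f \o h] for an orthogonal [h]; both
   are the mean of [f] over [O(n)], hence equal.  A functional [mu] in VConv_1
   that is additive therefore takes the same value at [f] and at [f \o h].

   Additivity on max-affine functions, which are dense in Conv, is proved by
   induction on the number of affine pieces: if [H = max h l] with [l] affine,
   the valuation property for [f + H + h] and [f + H + l] gives
   mu (f + 2H) = 2 mu (f + H) - mu f.  So mu (f + mH) is affine in the natural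
   number m, and its slope is mu H by homogeneity and continuity.

   No Haar measure is used: the means are uniform limits on compact sets of
   finite averages [F] of translates of [f].  An average becomes constant on a
   sphere because averaging over the moves taking each point of a finite net to
   a point where [F] is small lowers max F.  The same argument for right
   translations of [O(n)] yields the quadrature that makes the mean unique. *)
From HB Require Import structures.
Require Import Defs.
From mathcomp Require Import all_boot all_order all_algebra.
From mathcomp Require Import all_classical all_reals all_analysis.
From mathcomp Require Import ring lra.
Import Order.TTheory GRing.Theory Num.Theory.
Import numFieldNormedType.Exports.

Set Implicit Arguments.
Unset Strict Implicit.
Unset Printing Implicit Defensive.

Local Open Scope classical_set_scope.
Local Open Scope ring_scope.

(** * Convex functions *)

Section Conv.
Context {R : realType} {n : nat}.
Notation V := 'cV[R]_n.
Implicit Types (f h : V -> R) (x y : V).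

Lemma ConvP f : Conv R n f <-> forall (t : R) x y, 0 <= t <= 1 ->
  f (t *: x + (1 - t) *: y) <= t * f x + (1 - t) * f y.
Proof.
split=> [cf t x y t01|cf t x y _ _].
  have := cf (Itv01 (proj1 (andP t01)) (proj2 (andP t01))) x y.
  by rewrite !inE/= => /(_ Logic.I Logic.I).
by have := cf t%:num x y; apply; rewrite ge0 le1.
Qed.

Lemma ConvD f h : Conv R n f -> Conv R n h -> Conv R n (fun x => f x + h x).
Proof.
move=> /ConvP cf /ConvP ch; apply/ConvP => t x y t01.
by have := cf t x y t01; have := ch t x y t01; lra.
Qed.

Lemma ConvZ a f : 0 <= a -> Conv R n f -> Conv R n (fun x => a * f x).
Proof.
move=> a0 /ConvP cf; apply/ConvP => t x y t01.
by have := ler_wpM2l a0 (cf t x y t01); lra.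
Qed.

Lemma Conv_max f h : Conv R n f -> Conv R n h ->
  Conv R n (fun x => Num.max (f x) (h x)).
Proof.
move=> /ConvP cf /ConvP ch; apply/ConvP => t x y t01.
have [t0 t1] := andP t01.
have tx : t * f x <= t * Num.max (f x) (h x) by rewrite ler_wpM2l// le_max lexx.
have tx' : t * h x <= t * Num.max (f x) (h x)
  by rewrite ler_wpM2l// le_max lexx orbT.
have t1' : 0 <= 1 - t by lra.
have ty : (1 - t) * f y <= (1 - t) * Num.max (f y) (h y)
  by rewrite ler_wpM2l// le_max lexx.
have ty' : (1 - t) * h y <= (1 - t) * Num.max (f y) (h y)
  by rewrite ler_wpM2l// le_max lexx orbT.
have := cf t x y t01; have := ch t x y t01.
by rewrite ge_max => hh ff; apply/andP; split; lra.
Qed.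

Lemma Conv_affine (l : {scalar V}) (c : R) : Conv R n (fun x => l x + c).
Proof. by apply/ConvP => t x y t01; rewrite linearD !linearZ/=; lra. Qed.

Lemma Conv_mulmx f (g : 'M[R]_n) : Conv R n f -> Conv R n (fun x => f (g *m x)).
Proof.
by move=> /ConvP cf; apply/ConvP => t x y t01; rewrite mulmxDr -!scalemxAr cf.
Qed.

Lemma Conv_lim (F : nat -> V -> R) f : (forall k, Conv R n (F k)) ->
  (forall x, F k x @[k --> \oo] --> f x) -> Conv R n f.
Proof.
move=> cF Ff; apply/ConvP => t x y t01.
have Fr : t * F k x + (1 - t) * F k y @[k --> \oo] --> t * f x + (1 - t) * f y.
  by apply: cvgD; (apply: cvgM; [exact: cvg_cst|exact: Ff]).
apply: (ler_cvg_to (Ff (t *: x + (1 - t) *: y)) Fr).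
by near=> k; move/ConvP : (cF k); exact.
Unshelve. all: by end_near. Qed.

Definition dot (p x : V) : R := \sum_i p i 0 * x i 0.

Lemma dot_is_linear p : scalar (dot p).
Proof.
move=> a x y; rewrite /dot mulr_sumr -big_split/=; apply: eq_bigr => i _.
by rewrite !mxE; ring.
Qed.

HB.instance Definition _ (p : V) :=
  GRing.isLinear.Build R V R _ (dot p) (dot_is_linear p).

Lemma dotD p x y : dot p (x + y) = dot p x + dot p y.
Proof. exact: linearD. Qed.

Lemma dotZ p a x : dot p (a *: x) = a * dot p x.
Proof. exact: linearZ. Qed.

Lemma euclidean_norm_ge0 x : 0 <= euclidean_norm x.
Proof. exact: sqrtr_ge0. Qed.

Lemma le_euclidean_norm x i : `|x i 0| <= euclidean_norm x.
Proof.
rewrite -sqrtr_sqr ler_wsqrtr// (bigD1 i)//= lerDl sumr_ge0// => j _.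
exact: sqr_ge0.
Qed.

Lemma euclidean_norm_le x (d : R) : (forall i, `|x i 0| <= d) ->
  euclidean_norm x <= n%:R * d.
Proof.
move=> xd; case: (posnP n) => [n0|n0].
  rewrite /euclidean_norm big1 ?sqrtr0 ?n0 ?mul0r// => i _.
  by have := ltn_ord i; rewrite [X in (_ < X)%N]n0.
have d0 : 0 <= d by apply: le_trans (xd (Ordinal n0)).
rewrite -[leRHS]ger0_norm ?mulr_ge0// -sqrtr_sqr ler_wsqrtr//.
apply: (@le_trans _ _ (\sum_(i < n) d ^+ 2)).
  by apply: ler_sum => i _; rewrite -(real_normK (num_real _)) lerXn2r ?nnegrE.
rewrite sumr_const card_ord -[leLHS]mulr_natl exprMn ler_wpM2r ?sqr_ge0//.
rewrite -natrX ler_nat; case: (posnP n) => [->//|n_gt0].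
by rewrite -[leqLHS]expn1 leq_pexp2l.
Qed.

Lemma euclidean_normZ a x : 0 <= a ->
  euclidean_norm (a *: x) = a * euclidean_norm x.
Proof.
move=> a0; rewrite /euclidean_norm.
under eq_bigr do rewrite mxE exprMn.
by rewrite -mulr_sumr sqrtrM ?sqr_ge0// sqrtr_sqr ger0_norm.
Qed.

Lemma euclidean_norm_orthogonal (g : 'M[R]_n) x : orthogonal_group R n g ->
  euclidean_norm (g *m x) = euclidean_norm x.
Proof.
move=> /mulmx1C gg.
have E y : \sum_(i < n) y i 0 ^+ 2 = (y^T *m y : 'M[R]_1) 0 0.
  by rewrite mxE; apply: eq_bigr => i _; rewrite mxE expr2.
by rewrite /euclidean_norm !E trmx_mul mulmxA -(mulmxA x^T) gg mulmx1.
Qed.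

End Conv.

(** * Continuity of valuations along locally uniformly convergent sequences *)

Definition cvg_locally_uniformly {R : realType} {n : nat}
    (F : nat -> 'cV[R]_n -> R) (f : 'cV[R]_n -> R) : Prop :=
  forall r e : R, 0 < e -> \forall k \near \oo,
    forall x, euclidean_norm x <= r -> `|F k x - f x| <= e.

Section Valuation.
Context {R : realType} {n : nat}.
Notation V := 'cV[R]_n.
Variable mu : funspace R n -> R.
Hypothesis mu_V : VConv1 R n mu.
Implicit Types (f h : V -> R) (x y : V).

Lemma VConv1_cvg (F : nat -> V -> R) f : Conv R n f ->
  (forall k, Conv R n (F k)) -> cvg_locally_uniformly F f ->
  mu (F k) @[k --> \oo] --> mu f.
Proof.
move=> cf cF Ff; case: mu_V => -[] /subspace_continuousP + _ _ _ => /(_ f cf).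
apply: cvg_comp.
have FF : (F : nat -> funspace R n) k @[k --> \oo] --> (f : funspace R n).
  apply/fam_cvgP => A cA; move=> P /uniform_nbhs[E [entE EP]].
  have [e e0 eE] : exists2 e : R, 0 < e & forall a b : R, `|a - b| <= e -> E (a, b).
    move: entE; rewrite -entourage_ballE => -[e /= e0 eE].
    (* Halving passes from the strict inequality of a ball to a non-strict one. *)
    exists (e / 2); first by rewrite divr_gt0.
    move=> a b ab; apply: eE; rewrite /= /ball/=.
    by rewrite (le_lt_trans ab)// ltr_pdivrMr// ltr_pMr// ltr1n.
  (* [MA] bounds the sup norm on [A] by any number above [M]; the factor [n] then passes to the
     Euclidean norm. *)
  have [M [_ MA]] := compact_bounded cA.
  have := Ff (n%:R * (`|M| + 1)) e e0.
  apply: filterS => k kF; apply: EP => y Ay; apply: eE.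
  rewrite distrC kF// euclidean_norm_le// => i.
  apply: le_trans (MA (`|M| + 1) _ _ Ay); last first.
    by rewrite (le_lt_trans (ler_norm _))// ltrDl.
  rewrite [leRHS]/Num.norm/= mx_normrE.
  by apply/bigmax_geP; right; exists (i, 0).
move=> P /FF FP; have : \forall k \near \oo, Conv R n (F k) -> P (F k) := FP.
by apply: filterS => k; apply; exact: cF.
Qed.

End Valuation.

(** * Local bounds and subgradients *)

Section ConvexAnalysis.
Context {R : realType} {n : nat}.
Notation V := 'cV[R]_n.
Implicit Types (f h : V -> R) (x y v w : V).

Definition supported_below (k : nat) v := forall i : 'I_n, (k <= i)%N -> v i 0 = 0.

Lemma supported_belowS k (kn : (k < n)%N) x : supported_below k.+1 x ->
  let i := Ordinal kn in
  exists2 v, supported_below k v & x = v + x i 0 *: delta_mx i 0 /\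
    forall j, v j 0 = if j == i then 0 else x j 0.
Proof.
move=> kx i; exists (\col_j (if j == i then 0 else x j 0)).
  move=> j kj; rewrite mxE; case: ifPn => // ji; apply: kx.
  rewrite ltn_neqAle kj andbT; apply: contra ji => /eqP kj'.
  by apply/eqP/val_inj.
split=> [|j]; last by rewrite mxE.
apply/colP => j; rewrite !mxE eqxx andbT.
by case: eqVneq => [->|_]/=; rewrite ?mulr1 ?mulr0 ?addr0 ?add0r.
Qed.

(** Upper bounds come by induction on the number of coordinates: [x] is the midpoint of a point with
    one coordinate fewer and a point on an axis, where two endpoint values control [f]. *)
Lemma Conv_bounded f (K : R) : Conv R n f ->
  exists M, forall x, (forall i, `|x i 0| <= K) -> `|f x| <= M.
Proof.
move=> /ConvP cf.
have [M fM] : exists M, forall x, (forall i, `|x i 0| <= K) -> f x <= M.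
  suff : forall (k : nat) (K : R), exists M, forall x, (forall i, `|x i 0| <= K) ->
      supported_below k x -> f x <= M.
    move=> /(_ n K)[M fM]; exists M => x xK; apply: fM => // i ni.
    by have := ltn_ord i; rewrite ltnNge ni.
  elim=> [|k IH] {}K.
    exists (f 0) => x _ x0; suff -> : x = 0 by [].
    by apply/colP => i; rewrite x0// mxE.
  case: (ltnP k n) => [kn|nk]; last first.
    have [M fM] := IH K; exists M => x xK _; apply: fM => // i ki.
    by have := ltn_ord i; rewrite ltnNge (leq_trans nk ki).
  have [M fM] := IH (2 * K).
  pose e : V := delta_mx (Ordinal kn) 0.
  (* The axis point [2 * s] lies in [[-S, S]]; the added 1 keeps [S] positive when [K] is 0. *)
  pose S := 2 * `|K| + 1.
  exists (2^-1 * M + 2^-1 * (`|f (S *: e)| + `|f (- S *: e)|)).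
  move=> x xK /(supported_belowS kn)[v kv [xE vE]].
  have K0 : 0 <= K by apply: le_trans (xK (Ordinal kn)).
  set s := x (Ordinal kn) 0 in xE.
  have S0 : 0 < S by rewrite /S; have := normr_ge0 K; lra.
  have -> : x = 2^-1 *: (2 *: v) + (1 - 2^-1) *: ((2 * s) *: e).
    by rewrite {1}xE; apply/colP => i; rewrite !mxE; field.
  have sK : `|s| <= K := xK _.
  have h1 : f (2 *: v) <= M.
    apply: fM => [i|i ki]; last by rewrite mxE kv// mulr0.
    rewrite mxE normrM ger0_norm// ler_wpM2l// vE; case: ifP => // _.
    by rewrite normr0.
  have h2 : f ((2 * s) *: e) <= `|f (S *: e)| + `|f (- S *: e)|.
    pose t := (2 * s + S) / (2 * S).
    have t01 : 0 <= t <= 1.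
      have := ger0_norm K0; move: sK; rewrite ler_norml => /andP[s1 s2] KE.
      rewrite /t divr_ge0/= ?ler_pdivrMr; rewrite /S ?KE; lra.
    have -> : (2 * s) *: e = t *: (S *: e) + (1 - t) *: (- S *: e).
      by rewrite !scalerA -scalerDl; congr (_ *: _); rewrite /t; field; lra.
    apply: le_trans (cf _ _ _ t01) _; apply: lerD.
      apply: le_trans (ler_norm _) _; rewrite normrM ger0_norm; last lra.
      by rewrite ler_piMl//; lra.
    apply: le_trans (ler_norm _) _; rewrite normrM ger0_norm; last lra.
    by rewrite ler_piMl//; lra.
  have := cf 2^-1 (2 *: v) ((2 * s) *: e); lra.
(* The lower bound follows by reflection: [2 * f 0 <= f x + f (- x)] and [f (- x) <= M]. *)
exists (`|M| + `|2 * f 0 - M|) => x xK.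
have fx := fM x xK.
have fNx : f (- x) <= M by apply: fM => i; rewrite mxE normrN.
have := cf 2^-1 x (- x).
have -> : 2^-1 *: x + (1 - 2^-1) *: - x = 0.
  by apply/colP => i; rewrite !mxE; lra.
have := ler_norm M; have := ler_norm (- (2 * f 0 - M)).
rewrite normrN ler_norml => ? ? ?.
by apply/andP; split; have := normr_ge0 M; have := normr_ge0 (2 * f 0 - M); lra.
Qed.

(* Hahn-Banach in finite dimension: the gradient is built one coordinate at a
   time. *)
Lemma Conv_subgradient f y : Conv R n f ->
  exists p : V, forall x, f y + dot p (x - y) <= f x.
Proof.
move=> /ConvP cf.
suff : forall k : nat, exists p : V, forall v, supported_below k v ->
    f y + dot p v <= f (y + v).
  move=> /(_ n)[p fp]; exists p => x.
  rewrite -[in leRHS](subrKC y x) fp// => i ni.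
  by have := ltn_ord i; rewrite ltnNge ni.
elim=> [|k [p IH]].
  exists 0 => v v0; have -> : v = 0 by apply/colP => i; rewrite v0// mxE.
  by rewrite linear0 !addr0.
case: (ltnP k n) => [kn|nk]; last first.
  exists p => v _; apply: IH => i ki.
  by have := ltn_ord i; rewrite ltnNge (leq_trans nk ki).
set i0 := Ordinal kn; pose e : V := delta_mx i0 0.
have cross v w (s t : R) : supported_below k v -> supported_below k w ->
    0 < s -> 0 < t -> (f y + dot p v - f (y + v - s *: e)) / s <=
                      (f (y + w + t *: e) - f y - dot p w) / t.
  move=> kv kw s0 t0.
  rewrite ler_pdivrMr// mulrAC ler_pdivlMr//.
  (* With this weight the two displacements along [e] cancel, so the induction hypothesis applies to
     the convex combination. *)
  pose a := s / (s + t).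
  have st : s + t != 0 by lra.
  have a01 : 0 <= a <= 1.
    by rewrite divr_ge0/= ?ler_pdivrMr; lra.
  have kvw : supported_below k (a *: w + (1 - a) *: v).
    by move=> i ki; rewrite !mxE kv// kw// !mulr0 addr0.
  have := le_trans (IH _ kvw) _.
  have -> : y + (a *: w + (1 - a) *: v) =
      a *: (y + w + t *: e) + (1 - a) *: (y + v - s *: e).
    apply/colP => i; rewrite !mxE /a; field; lra.
  move=> /(_ _ (cf _ _ _ a01)); rewrite dotD !dotZ.
  have aE u u' : (s + t) * (a * u + (1 - a) * u') = s * u + t * u'.
    by rewrite /a; field.
  have st0 : 0 <= s + t by lra.
  move=> /(ler_wpM2l st0). rewrite mulrDr !aE; lra.
(* By [cross], every slope in the direction [- e] is below every slope in the direction [e]; the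
   supremum of the former is the new gradient entry. *)
pose A := [set r | exists v (s : R), [/\ supported_below k v, 0 < s &
  r = (f y + dot p v - f (y + v - s *: e)) / s]].
have k0 : supported_below k (0 : V) by move=> i _; rewrite mxE.
have hA : has_sup A.
  split; first by exists ((f y + dot p 0 - f (y + 0 - 1 *: e)) / 1), 0, 1.
  exists ((f (y + 0 + 1 *: e) - f y - dot p 0) / 1) => _ [v [s [kv s0 ->]]].
  exact: cross.
pose c := sup A.
exists (\col_j (if j == i0 then c else p j 0)) => x /(supported_belowS kn).
rewrite -/i0 => -[v kv [xE vE]].
set s := x i0 0 in xE.
have -> : dot (\col_j (if j == i0 then c else p j 0)) x = dot p v + c * s.
  rewrite /dot (bigD1 i0)//= [in RHS](bigD1 i0)//= mxE eqxx vE eqxx mulr0 add0r.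
  rewrite addrC; congr (_ + _); apply: eq_bigr => j /negbTE jE.
  by rewrite mxE vE jE.
rewrite xE (addrA y) -/e.
have [s0|s0|s0] := ltgtP s 0; last by rewrite s0 mulr0 scale0r !addr0 IH.
  have Ns0 : 0 < - s by rewrite oppr_gt0.
  have : A ((f y + dot p v - f (y + v - (- s) *: e)) / (- s)) by exists v, (- s).
  move/(sup_upper_bound hA); rewrite ler_pdivrMr// -/c scaleNr opprK; lra.
suff : c <= (f (y + v + s *: e) - f y - dot p v) / s.
  by rewrite ler_pdivlMr//; lra.
apply: ge_sup; first by case: hA.
by move=> _ [w [t [kw t0 ->]]]; exact: cross.
Qed.

End ConvexAnalysis.

(** * Approximation by max-affine functions *)

(** Finitely many cells of a grid of mesh [d] meet [A]. Choosing one point of [A] in each of them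
    keeps the net inside [A]. *)
Lemma bounded_finite_net (R : realType) m k (A : set 'M[R]_(m, k)) (B d : R) :
  0 < d -> (forall x, A x -> forall i j, `|x i j| <= B) ->
  exists2 c : seq 'M[R]_(m, k), (forall y, y \in c -> A y) &
    forall x, A x -> exists2 y, y \in c & forall i j, `|x i j - y i j| <= d.
Proof.
move=> d0 AB.
pose N := Num.truncn (2 * B / d).
pose cell (x : 'M[R]_(m, k)) : 'M['I_N.+1]_(m, k) :=
  \matrix_(i, j) inord (Num.truncn ((x i j + B) / d)).
have ge0 x i j : A x -> 0 <= (x i j + B) / d.
  by move=> /AB/(_ i j); rewrite ler_norml => /andP[xB _]; rewrite divr_ge0//; lra.
have cellP x y : A x -> A y -> cell x = cell y ->
    forall i j, `|x i j - y i j| <= d.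
  have leN z i j : A z -> (Num.truncn ((z i j + B) / d) < N.+1)%N.
    move=> Az; rewrite ltnS; apply: le_truncn; rewrite ler_pM2r ?invr_gt0//.
    by move: (AB z Az i j); rewrite ler_norml => /andP[_ ?]; lra.
  move=> Ax Ay /matrixP xy i j.
  have := xy i j; rewrite !mxE => /(congr1 val); rewrite /= !inordK ?leN// => E.
  have := truncn_itv (ge0 x i j Ax); have := truncn_itv (ge0 y i j Ay).
  rewrite E -natr1 !ler_pdivlMr// !ltr_pdivrMr// => /andP[? ?] /andP[? ?].
  by rewrite ler_norml; apply/andP; split; lra.
have /choice[r rP] : forall s, exists y, (exists2 x, A x & cell x = s) ->
    A y /\ cell y = s.
  move=> s; case: (pselect (exists2 x, A x & cell x = s)) => [[x Ax xs]|ns].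
    by exists x.
  (* A default value for cells that miss [A]; they are filtered out of the net below. *)
  by exists 0 => /ns.
exists [seq r s | s <- enum {: 'M['I_N.+1]_(m, k)}
                & `[< exists2 x, A x & cell x = s >]].
  by move=> y /mapP[s]; rewrite mem_filter => /andP[/asboolP /rP[]] + _ _ ->.
move=> x Ax; have [|Ar rx] := rP (cell x); first by exists x.
exists (r (cell x)); last by apply: cellP.
apply/mapP; exists (cell x) => //; rewrite mem_filter mem_enum andbT.
by apply/asboolP; exists x.
Qed.

(** The [+ 1] yields a positive tolerance without separating the case [a = 0]. *)
Lemma mulr_divD1_le (R : realFieldType) (a d : R) : 0 <= a -> 0 <= d ->
  a * (d / (a + 1)) <= d.
Proof.
move=> a0 d0; rewrite mulrCA ler_piMr// ler_pdivrMr ?mul1r ?lerDl//.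
by rewrite ltr_wpDl.
Qed.

Section MaxAffine.
Context {R : realType} {n : nat}.
Notation V := 'cV[R]_n.
Implicit Types (f h : V -> R) (x y p : V).

Inductive maxaffine : (V -> R) -> Prop :=
| maxaffine_affine p (c : R) : maxaffine (fun x => dot p x + c)
| maxaffine_max h p (c : R) : maxaffine h ->
    maxaffine (fun x => Num.max (h x) (dot p x + c)).

Lemma Conv_maxaffine h : maxaffine h -> Conv R n h.
Proof.
elim=> [p c|{}h p c _ IH]; first exact: Conv_affine.
by apply: Conv_max => //; exact: Conv_affine.
Qed.

Lemma maxaffine_mulmx h (g : 'M[R]_n) : maxaffine h ->
  maxaffine (fun x => h (g *m x)).
Proof.
have dotM p x : dot p (g *m x) = dot (g^T *m p) x.
  have dotE q y : dot q y = (q^T *m y : 'M[R]_1) 0 0.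
    by rewrite mxE; apply: eq_bigr => i _; rewrite mxE.
  by rewrite !dotE trmx_mul trmxK mulmxA.
elim=> [p c|{}h p c _ IH].
  by under eq_fun do rewrite dotM; exact: maxaffine_affine.
by under eq_fun do rewrite dotM; exact: maxaffine_max.
Qed.

Lemma normr_dot_le p x (a b : R) : (forall i, `|p i 0| <= a) ->
  (forall i, `|x i 0| <= b) -> `|dot p x| <= n%:R * (a * b).
Proof.
move=> pa xb; apply: le_trans (ler_norm_sum _ _ _) _.
apply: (@le_trans _ _ (\sum_(i < n) a * b)).
  by apply: ler_sum => i _; rewrite normrM ler_pM.
by rewrite sumr_const card_ord [leRHS]mulr_natl.
Qed.

(** A global Lipschitz constant is shared by all orthogonal translates, which makes the averaging
    below uniform. *)
Lemma maxaffine_lipschitz h : maxaffine h -> exists2 L : R, 0 <= L &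
  forall x y, `|h x - h y| <= L * euclidean_norm (x - y).
Proof.
have lip p c : exists2 L : R, 0 <= L &
    forall x y, `|dot p x + c - (dot p y + c)| <= L * euclidean_norm (x - y).
  exists (n%:R * \sum_i `|p i 0|) => [|x y].
    by rewrite mulr_ge0// sumr_ge0.
  rewrite (_ : _ - _ = dot p (x - y)); last by rewrite linearB/=; lra.
  rewrite -mulrA; apply: normr_dot_le => i; last exact: le_euclidean_norm.
  by rewrite (bigD1 i)//= lerDl sumr_ge0.
elim=> [p c|{}h p c _ [L L0 hL]]; first exact: lip.
have [L' L'0 lL] := lip p c.
exists (L + L') => [|x y]; first exact: addr_ge0.
have := hL x y; have := lL x y; rewrite mulrDl.
have := euclidean_norm_ge0 (x - y).
move: (euclidean_norm _) => e /[dup] /(mulr_ge0 L0) + /(mulr_ge0 L'0).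
rewrite !ler_norml => ? ? /andP[? ?] /andP[? ?].
by case: (leP (h x)) => ?; case: (leP (h y)) => ?; apply/andP; split; lra.
Qed.

Lemma maxaffine_minorant f (p : V -> V) (c : seq V) :
  (forall y x, f y + dot (p y) (x - y) <= f x) ->
  exists h, [/\ maxaffine h, forall x, h x <= f x &
    forall y, y \in c -> forall x, f y + dot (p y) (x - y) <= h x].
Proof.
move=> fp.
have lE y x : f y + dot (p y) (x - y) = dot (p y) x + (f y - dot (p y) y).
  by rewrite linearB/=; ring.
elim: c => [|z c [h [mh hf ch]]].
  (* For the empty list the supporting plane at [0] serves as the first affine piece. *)
  exists (fun x => dot (p 0) x + (f 0 - dot (p 0) 0)); split=> //.
    exact: maxaffine_affine.
  by move=> x; rewrite -lE.
exists (fun x => Num.max (h x) (dot (p z) x + (f z - dot (p z) z))); split.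
- exact: maxaffine_max.
- by move=> x; rewrite ge_max hf -lE fp.
- move=> y; rewrite inE => /predU1P[-> x|yc x]; first by rewrite le_max lE lexx orbT.
  by rewrite le_max ch.
Qed.

(** The maximum of the supporting planes at the points of a fine net lies below [f]. At a nearby net
    point, the supporting planes at both points and the bound on gradients limit the gap. *)
Lemma maxaffine_approx f (K e : R) : Conv R n f -> 0 < e ->
  exists2 h, maxaffine h & forall x, (forall i, `|x i 0| <= K) -> `|h x - f x| <= e.
Proof.
move=> cf e0; have [M fM] := Conv_bounded (K + 1) cf.
have /choice[p fp] := fun y => Conv_subgradient y cf.
(* A unit step along a coordinate stays in the larger cube, so the slope is at most [M - f y]. *)
have pM y i : (forall i, `|y i 0| <= K) -> `|p y i 0| <= 2 * `|M|.
  move=> yK.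
  have dotd a : dot (p y) (a *: delta_mx i 0) = a * p y i 0.
    rewrite dotZ /dot (bigD1 i)//= mxE !eqxx mulr1 big1 ?addr0// => j /negbTE ji.
    by rewrite mxE ji mulr0.
  have := fM y; rewrite ler_norml => /(_ _)/andP[j|yM yM'].
    by rewrite (le_trans (yK j))// lerDl.
  have fa a : `|a| <= 1 -> f y + a * p y i 0 <= M.
    move=> a1; rewrite -dotd.
    have -> : a *: delta_mx i 0 = y + a *: delta_mx i 0 - y.
      by rewrite addrAC subrr add0r.
    apply: le_trans (fp y _) _.
    apply: le_trans (ler_norm _) (fM _ _) => j.
    rewrite !mxE; apply: le_trans (ler_normD _ _) _; rewrite lerD//.
    by rewrite eqxx andbT normrM; case: (j == i); rewrite /= ?normr1 ?normr0 ?mulr1 ?mulr0.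
  have := fa 1; have := fa (-1); rewrite normrN normr1 => /(_ (lexx _)) ? /(_ (lexx _)) ?.
  by have := ler_norm M; rewrite ler_norml => ?; apply/andP; split; lra.
(* Each of the two gradient terms is at most [n%:R * (2 * |M| * d)], and their sum must not exceed
   [e]. *)
pose d := e / (4 * n%:R * `|M| + 1).
have D0 : 0 < 4 * n%:R * `|M| + 1 by rewrite ltr_wpDl// !mulr_ge0.
have d0 : 0 < d by rewrite divr_gt0.
have [|c cK cnet] := @bounded_finite_net R n 1
  [set x | forall i, `|x i 0| <= K] K d d0.
  by move=> x xK i j; rewrite ord1.
have [h [mh hf hc]] := maxaffine_minorant c fp.
exists h => // x xK; have [y yc xy] := cnet x xK.
have h1 : `|dot (p y) (x - y)| <= n%:R * (2 * `|M| * d).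
  apply: normr_dot_le => i; first by apply: pM; exact: cK.
  by have := xy i 0; rewrite !mxE.
have h2 : `|dot (p x) (y - x)| <= n%:R * (2 * `|M| * d).
  apply: normr_dot_le => i; first exact: pM.
  by have := xy i 0; rewrite !mxE distrC.
have dE : 2 * (n%:R * (2 * `|M| * d)) <= e.
  rewrite (_ : _ * _ = 4 * n%:R * `|M| * d); last by ring.
  by apply: mulr_divD1_le; [rewrite !mulr_ge0|exact: ltW].
have := hf x; have := hc y yc x; have := fp x y.
move: h1 h2; rewrite !ler_norml => /andP[? ?] /andP[? ?] ? ? ?.
by apply/andP; split; lra.
Qed.

Lemma maxaffine_dense f : Conv R n f ->
  exists2 F : nat -> V -> R, forall k, maxaffine (F k) & cvg_locally_uniformly F f.
Proof.
move=> cf.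
have /choice[F FP] : forall k : nat, exists h, maxaffine h /\
    forall x, (forall i, `|x i 0| <= k%:R) -> `|h x - f x| <= k.+1%:R^-1.
  by move=> k; have [|h] := maxaffine_approx k%:R cf (_ : 0 < k.+1%:R^-1); [|exists h].
exists F => [k|r e e0]; first by case: (FP k).
have [N rN] : exists N : nat, r <= N%:R.
  by exists (Num.truncn `|r|).+1; rewrite (le_trans (ler_norm r))// ltW// truncnS_gt.
near=> k => x xr.
apply: le_trans ((FP k).2 x _) _.
  move=> i; apply: le_trans (le_euclidean_norm x i) _.
  apply: le_trans xr _; apply: le_trans rN _; rewrite ler_nat.
  by near: k; exact: nbhs_infty_ge.
by apply: ltW; near: k; exact: near_infty_natSinv_lt (PosNum e0).
Unshelve. all: by end_near. Qed.

End MaxAffine.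

(** * Additivity *)

Section Additivity.
Context {R : realType} {n : nat}.
Notation V := 'cV[R]_n.
Variable mu : funspace R n -> R.
Hypothesis mu_V : VConv1 R n mu.
Implicit Types (f h H : V -> R) (x y p : V).

Lemma VConv1_scale (t : R) f : 0 <= t -> Conv R n f ->
  mu (fun x => t * f x) = t * mu f.
Proof. by case: mu_V => _; apply. Qed.

Lemma VConv1_add_affine f p (c : R) : Conv R n f ->
  mu (fun x => f x + (dot p x + c)) = mu f.
Proof.
move=> cf; case: mu_V => -[_ _ tr] _; rewrite -(tr f (dot p) c cf).
by congr mu; apply/funext => x; rewrite addrA.
Qed.

Definition additive_at H := forall f, Conv R n f ->
  mu (fun x => f x + H x) = mu f + mu H.

Lemma additive_at_affine p (c : R) : additive_at (fun x => dot p x + c).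
Proof.
move=> f cf; rewrite VConv1_add_affine//.
have -> : mu (fun x => dot p x + c) = 0; last by rewrite addr0.
have c0 : Conv R n (fun=> 0) by apply/ConvP => *; lra.
transitivity (mu (fun=> 0)); last first.
  (* Homogeneity with factor 0 makes [mu] vanish at the zero function. *)
  rewrite -[RHS](mul0r (mu (fun=> 0))) -VConv1_scale//.
  by congr mu; apply/funext => x; rewrite mul0r.
rewrite -(VConv1_add_affine p c c0).
by congr mu; apply/funext => x; rewrite add0r.
Qed.

(* The valuation property is applied to [f + H + h] and [f + H + l], where
   [l] is affine and [H = max h l]: since [min h l + H = h + l], the minimum is
   [f + h + l], which is convex. *)
Lemma VConv1_add_max f h p (c : R) : Conv R n f -> Conv R n h ->
  additive_at h ->
  let H x := Num.max (h x) (dot p x + c) in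
  mu (fun x => f x + H x + H x) = 2 * mu (fun x => f x + H x) - mu f.
Proof.
move=> cf ch ah H; case: mu_V => -[_ val _] _.
have cl : Conv R n (fun x => dot p x + c) by exact: Conv_affine.
have cH : Conv R n H by exact: Conv_max.
have cfH := ConvD cf cH.
have maxE : (fun x => Num.max (f x + H x + h x) (f x + H x + (dot p x + c))) =
    (fun x => f x + H x + H x) by apply/funext => x; rewrite -addr_maxr.
have minE : (fun x => Num.min (f x + H x + h x) (f x + H x + (dot p x + c))) =
    (fun x => f x + h x + (dot p x + c)).
  by apply/funext => x; rewrite -addr_minr /H; case: leP => _; lra.
have := val (fun x => f x + H x + h x) (fun x => f x + H x + (dot p x + c)).
rewrite maxE minE !VConv1_add_affine//; last exact: ConvD.
rewrite !ah// => E; have : mu (fun x => f x + H x + H x) + (mu f + mu h) =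
  mu (fun x => f x + H x) + mu h + mu (fun x => f x + H x).
  by apply: E; do ?exact: ConvD; exact: (ConvD (ConvD cf ch) cl).
by lra.
Qed.

Lemma additive_at_max h p (c : R) : Conv R n h -> additive_at h ->
  additive_at (fun x => Num.max (h x) (dot p x + c)).
Proof.
move=> ch ah f cf; set H := fun x => Num.max (h x) (dot p x + c).
have cH : Conv R n H by apply: Conv_max => //; exact: Conv_affine.
pose u (m : nat) := mu (fun x => f x + m%:R * H x).
have cu (m : nat) : Conv R n (fun x => f x + m%:R * H x).
  by apply: ConvD => //; exact: ConvZ.
have uS m : u m.+2 = 2 * u m.+1 - u m.
  have -> : u m.+2 = mu (fun x => f x + m%:R * H x + H x + H x).
    by congr mu; apply/funext => x; rewrite -!natr1; ring.
  rewrite VConv1_add_max//; congr (2 * mu _ - _).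
  by apply/funext => x; rewrite -/(H x) -!natr1; ring.
have uE m : u m = u 0%N + m%:R * (u 1%N - u 0%N).
  (* The recursion has order two, so the induction carries two consecutive values. *)
  suff : u m = u 0%N + m%:R * (u 1%N - u 0%N) /\
    u m.+1 = u 0%N + m.+1%:R * (u 1%N - u 0%N) by case.
  elim: m => [|m [IH1 IH2]]; first by rewrite mul0r mul1r; split; ring.
  by split=> //; rewrite uS IH1 IH2 -!natr1; ring.
have u0 : u 0%N = mu f by congr mu; apply/funext => x; rewrite mul0r addr0.
have u1 : u 1%N = mu (fun x => f x + H x).
  by congr mu; apply/funext => x; rewrite mul1r.
(* [F k] tends to [H], while [mu (F k)] tends to the slope of [u]. *)
pose F (k : nat) x := k.+1%:R^-1 * (f x + k.+1%:R * H x).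
have muF k : mu (F k) = k.+1%:R^-1 * mu f + (u 1%N - mu f).
  transitivity (k.+1%:R^-1 * u k.+1).
    by apply: VConv1_scale; [rewrite invr_ge0|exact: cu].
  by rewrite uE u0 mulrDr mulKf.
have FH : mu (F k) @[k --> \oo] --> mu H.
  apply: VConv1_cvg => // [k|r e e0].
    by apply: ConvZ; rewrite ?invr_ge0//; exact: cu.
  have [M fM] := Conv_bounded r cf.
  have M0 : 0 < `|M| + 1 by rewrite ltr_wpDl.
  have e1 : 0 < e / (`|M| + 1) by rewrite divr_gt0.
  have : \forall k \near \oo, k.+1%:R^-1 < e / (`|M| + 1) :> R.
    exact: near_infty_natSinv_lt (PosNum e1).
  apply: filterS => k ke x xr.
  rewrite /F mulrDr mulKf ?pnatr_eq0// addrK normrM ger0_norm ?invr_ge0//.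
  have xM : `|f x| <= `|M| + 1.
    have := fM x (fun i => le_trans (le_euclidean_norm x i) xr).
    by have := ler_norm M; lra.
  rewrite -(divfK (lt0r_neq0 M0) e).
  by apply: ler_pM; rewrite ?invr_ge0// ltW.
have FH' : mu (F k) @[k --> \oo] --> 0 * mu f + (u 1%N - mu f).
  under eq_fun do rewrite muF.
  by apply: cvgD; [apply: cvgM; [exact: cvg_harmonic|]|]; exact: cvg_cst.
have := cvg_unique (@norm_hausdorff _ _) FH FH' => ->.
by rewrite mul0r add0r -u1 addrC subrK.
Qed.

Lemma maxaffine_additive h : maxaffine h -> additive_at h.
Proof.
elim=> [p c|{}h p c mh IH]; first exact: additive_at_affine.
by apply: additive_at_max => //; exact: Conv_maxaffine.
Qed.

(** Homogeneity moves the factor one half outside, and [h], then [f], split off from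
    [2 * k + f + h]. Thus additivity passes to averages, which need not be max-affine by
    construction. *)
Lemma additive_at_half f h : Conv R n f -> Conv R n h ->
  additive_at f -> additive_at h ->
  additive_at (fun x => 2^-1 * (f x + h x)).
Proof.
move=> cf ch af ah k ck.
have h2 : 0 <= 2^-1 :> R by rewrite invr_ge0.
rewrite VConv1_scale//; last exact: ConvD.
have -> : (fun x => k x + 2^-1 * (f x + h x)) =
    (fun x => 2^-1 * (2 * k x + f x + h x)) by apply/funext => x; field.
have c2k : Conv R n (fun x => 2 * k x) by exact: ConvZ.
rewrite VConv1_scale//; last by do ?apply: ConvD.
by rewrite (ah _ (ConvD c2k cf)) (af _ c2k) (ah _ cf) VConv1_scale//; field.
Qed.

End Additivity.

(** * Finite averages over transitive groups *)

Section Averages.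
Context {R : realType} {T : eqType}.
Implicit Types (f F : T -> R) (S : set (T -> T)) (X : set T).

(** Convex combinations of translates with dyadic weights; building them by midpoints leaves one
    orbit case and one midpoint case in each induction. *)
Inductive average S f : (T -> R) -> Prop :=
| average_orbit s : S s -> average S f (fun x => f (s x))
| average_half F F' : average S f F -> average S f F' ->
    average S f (fun x => 2^-1 * (F x + F' x)).

Lemma average_comp S f F s : (forall s t, S s -> S t -> S (fun x => s (t x))) ->
  S s -> average S f F -> average S f (fun x => F (s x)).
Proof.
move=> SM Ss; elim=> [t St|F1 F2 _ IH1 _ IH2]; last exact: average_half.
by apply: (@average_orbit S f (fun x => t (s x))); exact: SM.
Qed.

Lemma average_trans S f F F' : (forall s t, S s -> S t -> S (fun x => s (t x))) ->
  average S f F -> average S F F' -> average S f F'.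
Proof.
move=> SM fF; elim=> [s Ss|F1 F2 _ IH1 _ IH2]; first exact: average_comp.
exact: average_half.
Qed.

Lemma average_dist S f F x y (e : R) :
  (forall s, S s -> `|f (s x) - f (s y)| <= e) ->
  average S f F -> `|F x - F y| <= e.
Proof.
move=> fxy; elim=> [s Ss|F1 F2 _ + _]; first exact: fxy.
by rewrite !ler_norml => /andP[? ?] /andP[? ?]; apply/andP; split; lra.
Qed.

Lemma average_ge S f F x (a : R) :
  (forall s, S s -> a <= f (s x)) -> average S f F -> a <= F x.
Proof. by move=> fxy; elim=> [s Ss|F1 F2 _ ? _ ?]; [exact: fxy|lra]. Qed.

Section Oscillation.
Variables (S : set (T -> T)) (X : set T) (f : T -> R).
Hypothesis S_id : S id.
Hypothesis S_comp : forall s t, S s -> S t -> S (fun x => s (t x)).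
Hypothesis S_stable : forall s x, S s -> X x -> X (s x).
Hypothesis S_transitive : forall x y, X x -> X y -> exists2 s, S s & s x = y.
(** Total boundedness of [X] for the pseudometric given by the supremum over [s] of
    [|f (s x) - f (s y)|]; all averages of [f] are 1-Lipschitz for it. *)
Hypothesis f_net : forall e : R, 0 < e -> exists2 c : seq T,
  (forall y, y \in c -> X y) & forall x, X x -> exists2 y, y \in c &
    forall s, S s -> `|f (s x) - f (s y)| <= e.

(* Moving each point of the net in turn onto a point where [F] is small lowers
   the maximum of [F] by a fixed amount. *)
Lemma average_lower_max F x0 (M d : R) (c : seq T) : 0 < d ->
  (forall y, y \in c -> X y) -> X x0 ->
  average S f F -> (forall x, X x -> F x <= M) -> F x0 <= M - 2 * d ->
  exists F', [/\ average S f F', forall x, X x -> F' x <= M &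
    forall x y, X x -> y \in c ->
      (forall s, S s -> `|f (s x) - f (s y)| <= d) ->
      F' x <= M - d / 2 ^+ size c].
Proof.
move=> d0 + Xx0 fF FM Fx0; elim: c => [|y c IH] cX; first by exists F.
have [|F' [fF' F'M F'c]] := IH; first by move=> z zc; apply: cX; rewrite inE zc orbT.
have [s Ss sy] := S_transitive (cX y (mem_head _ _)) Xx0.
have p0 : 0 < d / 2 ^+ size c by rewrite divr_gt0// exprn_gt0.
have p1 : d / 2 ^+ size c <= d.
  by rewrite ler_pdivrMr ?exprn_gt0// ler_peMr//; [exact: ltW|rewrite -natrX ler1n expn_gt0].
have pE : d / 2 ^+ (size c).+1 = 2^-1 * (d / 2 ^+ size c).
  by rewrite exprS invfM mulrCA.
(* Near [y] the first term is at most [M - d], a gain of at least [d / 2]; near the earlier net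
   points half of the previous gain survives. *)
exists (fun x => 2^-1 * (F (s x) + F' x)); split => [|x Xx|x z Xx].
- by apply: average_half => //; exact: average_comp.
- by have := F'M x Xx; have := FM (s x) (S_stable Ss Xx); lra.
rewrite /= pE inE => /predU1P[->|zc] xz; last first.
  by have := F'c x z Xx zc xz; have := FM (s x) (S_stable Ss Xx); lra.
have : `|F (s x) - F (s y)| <= d.
  by apply: average_dist fF => t St; exact: (xz _ (S_comp St Ss)).
by rewrite sy ler_norml => /andP[_ ?]; have := F'M x Xx; lra.
Qed.

(** If every average oscillated by more than [e], its maximum could be lowered by a fixed amount
    again and again, falling below the lower bound [- B] that all averages share. *)
Lemma average_small_oscillation (e : R) : 0 < e ->
  exists2 F, average S f F & forall x y, X x -> X y -> `|F x - F y| <= e.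
Proof.
move=> e0.
have [c cX cnet] := f_net (divr_gt0 e0 (ltr0n _ 2)).
set d := e / 2 in cnet.
have d0 : 0 < d by rewrite divr_gt0.
have [[x0 Xx0]|X0] := pselect (exists x, X x); last first.
  by exists (fun x => f (id x)) => [|x y Xx]; [exact: average_orbit|case: X0; exists x].
pose B := \sum_(y <- c) `|f y| + d.
have fB x : X x -> `|f x| <= B.
  move=> /cnet[y yc /(_ id S_id) xy].
  rewrite -(subrK (f y) (f x)) addrC; apply: le_trans (ler_normD _ _) _.
  apply: lerD xy; rewrite (big_rem y)//= lerDl sumr_ge0//.
apply: contrapT => nF.
have step F M : average S f F -> (forall x, X x -> F x <= M) ->
    exists2 F', average S f F' & forall x, X x -> F' x <= M - d / 2 ^+ size c.
  move=> fF FM.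
  (* Since [2 * d] is [e], either [F] is low enough somewhere to be improved, or its values on [X]
     lie within [e] of each other. *)
  have [[x Xx xM]|nx] := pselect (exists2 x, X x & F x <= M - 2 * d).
    have [F' [fF' _ F'M]] := average_lower_max d0 cX Xx fF FM xM.
    by exists F' => // z Xz; have [y yc yz] := cnet z Xz; exact: (F'M z y).
  case: nF; exists F => // x y Xx Xy.
  have H z : X z -> M - e < F z.
    move=> Xz; rewrite ltNge; apply/negP => zM; apply: nx; exists z => //.
    by rewrite /d; lra.
  have := H x Xx; have := H y Xy; have := FM x Xx; have := FM y Xy.
  by rewrite ler_norml => ? ? ? ?; apply/andP; split; lra.
have steps (k : nat) : exists2 F, average S f F &
    forall x, X x -> F x <= B - k%:R * (d / 2 ^+ size c).
  elim: k => [|k [F fF FM]].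
    exists (fun x => f (id x)) => [|x Xx]; first exact: average_orbit.
    by rewrite mul0r subr0 (le_trans (ler_norm _) (fB x Xx)).
  have [F' fF' F'M] := step F _ fF FM; exists F' => // x Xx.
  by have := F'M x Xx; rewrite -natr1; lra.
have p0 : 0 < d / 2 ^+ size c by rewrite divr_gt0// exprn_gt0.
pose k := (Num.truncn (2 * B / (d / 2 ^+ size c))).+1.
have [F fF FM] := steps k.
have FB : - B <= F x0.
  apply: average_ge fF => s Ss.
  by have := fB _ (S_stable Ss Xx0); rewrite ler_norml => /andP[].
have : 2 * B < k%:R * (d / 2 ^+ size c) by rewrite -ltr_pdivrMr// truncnS_gt.
by have := FM x0 Xx0; lra.
Qed.

End Oscillation.
End Averages.

(** * Finite quadrature rules *)

Section Means.
Context {R : realType} {T : Type}.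
Implicit Types (F : T -> R) (Y : set T).

Inductive mean Y : ((T -> R) -> R) -> Prop :=
| mean_point y : Y y -> mean Y (fun F => F y)
| mean_half Q Q' : mean Y Q -> mean Y Q' -> mean Y (fun F => 2^-1 * (Q F + Q' F)).

Lemma mean_dist Y Q F (a e : R) : mean Y Q ->
  (forall y, Y y -> `|F y - a| <= e) -> `|Q F - a| <= e.
Proof.
move=> mQ Fa; elim: mQ => [y|Q1 Q2 _ + _]; first exact: Fa.
by rewrite !ler_norml => /andP[? ?] /andP[? ?]; apply/andP; split; lra.
Qed.

Lemma mean_halfE Y Q F F' : mean Y Q ->
  Q (fun x => 2^-1 * (F x + F' x)) = 2^-1 * (Q F + Q F').
Proof. by elim=> [//|Q1 Q2 _ -> _ ->]; lra. Qed.

End Means.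

(** * Radial averages *)

Section GroupAverages.
Context {R : realType} {n : nat}.
Notation V := 'cV[R]_n.
Notation On := (orthogonal_group R n).
Implicit Types (f F : V -> R) (x y : V) (G : set 'M[R]_n).

Definition linear_action G : set (V -> V) := (fun g x => g *m x) @` G.

(** Right translations commute with left multiplication, so averaging [h => f (h *m x)] over them
    yields a quadrature with nodes [v *m x], the same for every [h]. *)
Definition right_translations : set ('M[R]_n -> 'M[R]_n) :=
  (fun v h => h *m v) @` On.

Lemma orthogonal_group_mul g h : On g -> On h -> On (g *m h).
Proof.
by rewrite /orthogonal_group/= => gg hh; rewrite trmx_mul mulmxA -(mulmxA g) hh mulmx1.
Qed.

Lemma orthogonal_groupT g : On g -> On g^T.
Proof. by rewrite /orthogonal_group/= trmxK => /mulmx1C. Qed.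

Lemma orthogonal_group1 : On 1%:M.
Proof. by rewrite /orthogonal_group/= trmx1 mulmx1. Qed.

Lemma orthogonal_entry_le (g : 'M[R]_n) i j : On g -> `|g i j| <= n%:R.
Proof.
move=> Og; have -> : g i j = (g *m delta_mx j 0 : V) i 0 by rewrite -colE mxE.
apply: le_trans (le_euclidean_norm _ _) _; rewrite euclidean_norm_orthogonal//.
rewrite -[leRHS]mulr1; apply: euclidean_norm_le => k; rewrite mxE.
by case: (_ && _); rewrite ?normr1 ?normr0.
Qed.

Definition lipschitz (L : R) f := forall x y, `|f x - f y| <= L * euclidean_norm (x - y).

Lemma average_lipschitz G L f F : G `<=` On -> lipschitz L f ->
  average (linear_action G) f F -> lipschitz L F.
Proof.
move=> GO fL fF x y; apply: average_dist fF => _ [g Gg <-].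
by apply: le_trans (fL _ _) _; rewrite -mulmxBr euclidean_norm_orthogonal//; exact: GO.
Qed.

Lemma average_orthogonal_quadrature L f x (e : R) : 0 <= L -> lipschitz L f -> 0 < e ->
  exists Q b, mean [set y | euclidean_norm y = euclidean_norm x] Q /\
    forall h, On h -> `|Q (fun y => f (h *m y)) - b| <= e.
Proof.
move=> L0 fL e0.
have [|||||F fF Fosc] := @average_small_oscillation R 'M[R]_n right_translations
    On (fun h => f (h *m x)) _ _ _ _ _ e e0.
- by exists 1%:M; [exact: orthogonal_group1|apply/funext => h; rewrite mulmx1].
- move=> _ _ [v Ov <-] [w Ow <-]; exists (w *m v); first exact: orthogonal_group_mul.
  by apply/funext => h; rewrite mulmxA.
- by move=> _ h [v Ov <-] Oh; exact: orthogonal_group_mul.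
- move=> g h Og Oh; exists (fun k => k *m (g^T *m h)).
    by exists (g^T *m h) => //; apply: orthogonal_group_mul => //; exact: orthogonal_groupT.
  by rewrite mulmxA Og mul1mx.
- move=> d d0; set r := euclidean_norm x; have r0 : 0 <= r := euclidean_norm_ge0 _.
  (* If the entries of [h] and [k] differ by at most a tolerance, the coordinates of
     [(h - k) *m (v *m x)] are at most [n%:R * r] times it; another [n] bounds the norm. *)
  pose D := L * (n%:R * (n%:R * r)).
  have D0 : 0 <= D by rewrite !mulr_ge0.
  have [||c cO cnet] := @bounded_finite_net R n n On n%:R (d / (D + 1)).
  + by rewrite divr_gt0// ltr_wpDl.
  + by move=> h Oh i j; exact: orthogonal_entry_le.
  exists c => // h Oh; have [k kc hk] := cnet h Oh; exists k => // _ [v Ov <-].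
  rewrite -!mulmxA; apply: le_trans (fL _ _) _; rewrite -mulmxBl.
  apply: (@le_trans _ _ (D * (d / (D + 1)))); last first.
    by apply: mulr_divD1_le => //; exact: ltW.
  rewrite /D -!mulrA ler_wpM2l//; apply: euclidean_norm_le => i; rewrite mxE.
  apply: le_trans (ler_norm_sum _ _ _) _.
  apply: (@le_trans _ _ (\sum_(j < n) (d / (D + 1)) * r)).
    apply: ler_sum => j _; rewrite normrM ler_pM//.
      by have := hk i j; rewrite !mxE.
    by rewrite /r -(euclidean_norm_orthogonal x Ov) le_euclidean_norm.
  by rewrite sumr_const card_ord -[leLHS]mulr_natl [r * _]mulrC.
have [Q [mQ FQ]] : exists Q, mean [set y | euclidean_norm y = euclidean_norm x] Q /\
    forall h, F h = Q (fun y => f (h *m y)).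
  elim: fF => [_ [v Ov <-]|F1 F2 _ [Q1 [mQ1 FQ1]] _ [Q2 [mQ2 FQ2]]].
    exists (fun F => F (v *m x)); split; last by move=> h; rewrite mulmxA.
    by apply: mean_point => /=; exact: euclidean_norm_orthogonal.
  exists (fun F => 2^-1 * (Q1 F + Q2 F)); split; first exact: mean_half.
  by move=> h; rewrite FQ1 FQ2.
exists Q, (F 1%:M); split=> // h Oh; rewrite -FQ.
by apply: Fosc => //; exact: orthogonal_group1.
Qed.

(* Averaging over a quadrature for [O(n)] commutes with averaging over group
   elements, so every nearly radial average of [f] is close to the same value. *)
Lemma average_orthogonal_unique L f F F' x (e : R) : 0 <= L -> lipschitz L f -> 0 < e ->
  average (linear_action On) f F -> average (linear_action On) f F' ->
  (forall y, euclidean_norm y = euclidean_norm x -> `|F y - F x| <= e) ->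
  (forall y, euclidean_norm y = euclidean_norm x -> `|F' y - F' x| <= e) ->
  `|F x - F' x| <= 4 * e.
Proof.
move=> L0 fL e0 fF fF' Fx F'x.
have [Q [b [mQ Qb]]] := average_orthogonal_quadrature x L0 fL e0.
suff near_b F0 : average (linear_action On) f F0 ->
    (forall y, euclidean_norm y = euclidean_norm x -> `|F0 y - F0 x| <= e) ->
    `|F0 x - b| <= 2 * e.
  have := near_b F fF Fx; have := near_b F' fF' F'x.
  by rewrite !ler_norml => /andP[? ?] /andP[? ?]; apply/andP; split; lra.
move=> fF0 F0x; have : `|Q F0 - b| <= e.
  elim: fF0 => [_ [h Oh <-]|F1 F2 _ + _]; first exact: Qb.
  rewrite (mean_halfE _ _ mQ) !ler_norml => /andP[? ?] /andP[? ?].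
  by apply/andP; split; lra.
(* The nodes of [Q] lie on the sphere through [x], where [F0] is nearly constant, so [Q F0] is also
   near [F0 x]. *)
have := mean_dist mQ F0x.
by rewrite !ler_norml => /andP[? ?] /andP[? ?]; apply/andP; split; lra.
Qed.

(** * Averages over a transitive group that are nearly radial *)

Section Transitive.
Variable G : set 'M[R]_n.
Hypotheses (G_subgroup : subgroup_GL G) (GO : G `<=` On).
Hypothesis G_transitive : transitive_on_sphere G.

Lemma linear_action_id : linear_action G id.
Proof.
case: G_subgroup => _ G1 _ _; exists 1%:M => //.
by apply/funext => x; rewrite mul1mx.
Qed.

Lemma linear_action_comp s t : linear_action G s -> linear_action G t ->
  linear_action G (fun x => s (t x)).
Proof.
case: G_subgroup => _ _ GM _ [g Gg <-] [h Gh <-]; exists (g *m h); first exact: GM.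
by apply/funext => x; rewrite mulmxA.
Qed.

Lemma euclidean_norm_eq0 x : euclidean_norm x = 0 -> x = 0.
Proof.
move=> x0; apply/colP => i; rewrite mxE; apply/normr0_eq0/le_anti.
by rewrite normr_ge0 andbT -x0 le_euclidean_norm.
Qed.

Lemma average_sphere (rho L e : R) f : 0 <= L -> lipschitz L f -> 0 < e ->
  exists2 F, average (linear_action G) f F &
    forall x y, euclidean_norm x = rho -> euclidean_norm y = rho -> `|F x - F y| <= e.
Proof.
move=> L0 fL e0.
apply: (@average_small_oscillation R 'cV[R]_n (linear_action G)
    [set x | euclidean_norm x = rho] f _ _ _ _ _ e e0).
- exact: linear_action_id.
- exact: linear_action_comp.
- by move=> _ x [g Gg <-]/= <-; rewrite euclidean_norm_orthogonal//; exact: GO.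
- move=> x y /= xr yr.
  (* Spheres of negative radius are empty, that of radius 0 is a point, and the others are rescaled
     to the unit sphere. *)
  have [r0|r0|r0] := ltgtP rho 0.
  + by have := euclidean_norm_ge0 x; rewrite xr leNgt r0.
  + have unit z : euclidean_norm z = rho -> unit_sphere R n (rho^-1 *: z).
      by move=> zr; rewrite /unit_sphere/= euclidean_normZ ?invr_ge0 ?ltW// zr mulVf ?gt_eqF.
    have [g Gg gxy] := G_transitive (unit x xr) (unit y yr).
    exists (fun x => g *m x); first by exists g.
    move: gxy; rewrite -scalemxAr => /(congr1 (fun z => rho *: z)).
    by rewrite !scalerA divff ?gt_eqF// !scale1r.
  + exists id; first exact: linear_action_id.
    by rewrite (euclidean_norm_eq0 (etrans xr r0)) (euclidean_norm_eq0 (etrans yr r0)).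
- move=> d d0; have D0 : 0 <= L * n%:R by rewrite mulr_ge0.
  have [||c cX cnet] := @bounded_finite_net R n 1
     [set x | euclidean_norm x = rho] rho (d / (L * n%:R + 1)).
  + by rewrite divr_gt0// ltr_wpDl.
  + by move=> x /= <- i j; rewrite ord1 le_euclidean_norm.
  exists c => // x xr; have [y yc xy] := cnet x xr; exists y => // _ [g Gg <-].
  apply: le_trans (fL _ _) _.
  rewrite -mulmxBr euclidean_norm_orthogonal; last exact: GO.
  apply: (@le_trans _ _ (L * n%:R * (d / (L * n%:R + 1)))); last first.
    by apply: mulr_divD1_le => //; exact: ltW.
  rewrite -mulrA ler_wpM2l//; apply: euclidean_norm_le => i.
  by have := xy i 0; rewrite !mxE.
Qed.

(** The spheres are treated one after another: elements of [G] preserve each sphere, so further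
    averaging keeps the oscillation bounds already reached. *)
Lemma average_spheres (rs : seq R) (L e : R) f : 0 <= L -> lipschitz L f -> 0 < e ->
  exists2 F, average (linear_action G) f F &
    forall x y, euclidean_norm x \in rs -> euclidean_norm y = euclidean_norm x ->
      `|F x - F y| <= e.
Proof.
move=> L0 fL e0; elim: rs => [|rho rs [F fF Frs]].
  by exists (fun x => f (id x)) => //; apply: average_orbit; exact: linear_action_id.
have [F' FF' F'rho] := average_sphere rho L0 (average_lipschitz GO fL fF) e0.
exists F'; first exact: average_trans linear_action_comp fF FF'.
move=> x y; rewrite inE => /predU1P[xr yr|xrs yx].
  by apply: F'rho => //; rewrite yr.
apply: average_dist FF' => _ [g Gg <-].
by apply: Frs; rewrite !euclidean_norm_orthogonal//; exact: GO.
Qed.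

Lemma average_radial (K L e : R) f : 0 <= L -> lipschitz L f -> 0 < e ->
  exists2 F, average (linear_action G) f F &
    forall x y, euclidean_norm x <= K -> euclidean_norm y = euclidean_norm x ->
      `|F x - F y| <= e.
Proof.
(* Radii are sampled with step [d]. The Lipschitz bound costs [e / 3] for moving each of [x] and [y]
   inward to the sampled radius [j%:R * d], and the oscillation there costs the last third. *)
move=> L0 fL e0; pose d := e / (3 * (L + 1)).
have L1 : 0 < L + 1 by rewrite ltr_wpDl.
have d0 : 0 < d by rewrite divr_gt0// mulr_gt0.
have [F fF Frs] := average_spheres [seq i%:R * d | i <- iota 0 (Num.truncn (K / d)).+1]
  L0 fL (divr_gt0 e0 (ltr0n _ 3)).
exists F => // x y xK yx.
have FL := average_lipschitz GO fL fF.
set r := euclidean_norm x.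
have [r0|r0] := eqVneq r 0.
  rewrite (euclidean_norm_eq0 r0) (euclidean_norm_eq0 (etrans yx r0)) subrr normr0.
  exact: ltW.
have rge0 : 0 <= r := euclidean_norm_ge0 _.
have rgt0 : 0 < r by rewrite lt_neqAle eq_sym r0.
pose j := Num.truncn (r / d).
have /andP[jr rj] := truncn_itv (divr_ge0 rge0 (ltW d0)).
rewrite -/j ler_pdivlMr// in jr; rewrite -/j ltr_pdivrMr// -natr1 in rj.
pose a := j%:R * d / r.
have a0 : 0 <= a by rewrite divr_ge0// mulr_ge0// ltW.
have close z : euclidean_norm z = r -> `|F z - F (a *: z)| <= e / 3.
  move=> zr; apply: le_trans (FL _ _) _.
  rewrite -[X in X - _]scale1r -scalerBl euclidean_normZ; last first.
    by rewrite subr_ge0 /a ler_pdivrMr ?mul1r.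
  have -> : e / 3 = (L + 1) * d by rewrite /d; field; rewrite gt_eqF.
  rewrite zr mulrBl mul1r /a divfK//.
  by apply: ler_pM => //; [rewrite subr_ge0|rewrite lerDl|lra].
have := close x erefl; have := close y yx.
have : `|F (a *: x) - F (a *: y)| <= e / 3.
  apply: Frs; rewrite !euclidean_normZ// ?yx// -/r /a divfK//.
  apply/mapP; exists j => //; rewrite mem_iota/= add0n ltnS.
  by apply: le_truncn; rewrite ler_pM2r ?invr_gt0.
by rewrite !ler_norml => /andP[? ?] /andP[? ?] /andP[? ?]; apply/andP; split; lra.
Qed.

(** * Orthogonal invariance on max-affine functions *)

Section Invariant.
Variable mu : funspace R n -> R.
Hypotheses (mu_V : VConv1 R n mu) (mu_G : invariant_under G mu).

Lemma average_VConv1 h F : maxaffine h -> average (linear_action G) h F ->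
  [/\ Conv R n F, additive_at mu F & mu F = mu h].
Proof.
move=> mh; elim=> [_ [g Gg <-]|F1 F2 _ [c1 a1 E1] _ [c2 a2 E2]].
  have mhg := maxaffine_mulmx g mh.
  split; [exact: Conv_maxaffine|exact: maxaffine_additive|].
  by apply: mu_G => //; exact: Conv_maxaffine.
have h2 : 0 <= 2^-1 :> R by rewrite invr_ge0.
split; [by apply: ConvZ => //; exact: ConvD|exact: additive_at_half|].
by rewrite (VConv1_scale mu_V h2 (ConvD c1 c2)) a2// E1 E2; lra.
Qed.

Lemma maxaffine_orthogonal_invariant h (g : 'M[R]_n) : maxaffine h -> On g ->
  mu (fun x => h (g *m x)) = mu h.
Proof.
move=> mh Og; have [L L0 hL] := maxaffine_lipschitz mh.
have mhg := maxaffine_mulmx g mh.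
have hgL : lipschitz L (fun x => h (g *m x)).
  by move=> x y; have := hL (g *m x) (g *m y);
    rewrite -mulmxBr euclidean_norm_orthogonal.
pose eps (k : nat) : R := k.+1%:R^-1.
have pos k : 0 < eps k by rewrite invr_gt0.
have /choice[F FP] : forall k : nat, exists F, average (linear_action G) h F /\
    forall x y, euclidean_norm x <= k%:R -> euclidean_norm y = euclidean_norm x ->
      `|F x - F y| <= eps k.
  by move=> k; have [F] := average_radial k%:R L0 hL (pos k); exists F.
have /choice[F' F'P] : forall k : nat, exists F,
    average (linear_action G) (fun x => h (g *m x)) F /\
    forall x y, euclidean_norm x <= k%:R -> euclidean_norm y = euclidean_norm x ->
      `|F x - F y| <= eps k.
  by move=> k; have [F0] := average_radial k%:R L0 hgL (pos k); exists F0.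
(* Seen over [O(n)], both sequences average the same [h], because translating [h \o g] by [u] is
   translating [h] by [g *m u]. *)
have OF k : average (linear_action On) h (F k).
  elim: (FP k).1 => [_ [u Gu <-]|F1 F2 _ ? _ ?]; last exact: average_half.
  by apply: (@average_orbit _ _ (linear_action On) h (fun x => u *m x)); exists u => //; exact: GO.
have OF' k : average (linear_action On) h (F' k).
  elim: (F'P k).1 => [_ [u Gu <-]|F1 F2 _ ? _ ?]; last exact: average_half.
  under eq_fun do rewrite mulmxA.
  apply: (@average_orbit _ _ (linear_action On) h (fun x => g *m u *m x)).
  by exists (g *m u) => //; apply: orthogonal_group_mul => //; exact: GO.
have FF' k x : euclidean_norm x <= k%:R -> `|F k x - F' k x| <= 4 * eps k.
  move=> xk; apply: (average_orthogonal_unique L0 hL) => // y yx.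
    by apply: (FP k).2; rewrite yx.
  by apply: (F'P k).2; rewrite yx.
have FF k m x : (k <= m)%N -> euclidean_norm x <= k%:R ->
    `|F k x - F m x| <= 4 * eps k.
  move=> km xk; apply: (average_orthogonal_unique L0 hL) => // y yx.
    by apply: (FP k).2; rewrite yx.
  apply: le_trans ((FP m).2 _ _ _ _) _ => //.
    by rewrite yx (le_trans xk)// ler_nat.
  by rewrite /eps lef_pV2 ?posrE// ler_nat.
(* The intervals of radius [4 * eps k] around [F k x] meet pairwise, so the supremum of their left
   ends lies in all of them: a limit with an explicit rate. *)
pose A x := [set F k x - 4 * eps k | k in [set k : nat | euclidean_norm x <= k%:R]].
pose r x := sup (A x).
have Aub x (k : nat) : euclidean_norm x <= k%:R -> ubound (A x) (F k x + 4 * eps k).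
  move=> xk _ [m /= xm <-].
  have := pos k; have := pos m.
  have [km|mk] := leqP k m.
    by have := FF k m x km xk; rewrite ler_norml => /andP[? ?] ? ?; lra.
  by have := FF m k x (ltnW mk) xm; rewrite ler_norml => /andP[? ?] ? ?; lra.
have Fr k x : euclidean_norm x <= k%:R -> `|F k x - r x| <= 4 * eps k.
  move=> xk.
  have Ak : A x (F k x - 4 * eps k) by exists k.
  have hA : has_sup (A x).
    by split; [exists (F k x - 4 * eps k)|exists (F k x + 4 * eps k); exact: Aub].
  have := sup_upper_bound hA Ak; have := ge_sup hA.1 (Aub x k xk); rewrite -/(r x).
  by rewrite ler_norml => ? ?; apply/andP; split; lra.
(* The constant 8 leaves room for [F']: four from [F'] to [F] and four from [F] to [r]. *)
have cvg_of (F0 : nat -> V -> R) : (forall k x, euclidean_norm x <= k%:R ->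
    `|F0 k x - r x| <= 8 * eps k) -> cvg_locally_uniformly F0 r.
  move=> F0r K e e0; have e8 : 0 < e / 8 by rewrite divr_gt0.
  have k8 : \forall k \near \oo, eps k < e / 8.
    exact: near_infty_natSinv_lt (PosNum e8).
  near=> k => x xK; apply: le_trans (F0r k x _) _.
    apply: le_trans xK _; apply: (@le_trans _ _ (Num.truncn `|K|).+1%:R).
      by rewrite (le_trans (ler_norm K))// ltW// truncnS_gt.
    by rewrite ler_nat; near: k; exact: nbhs_infty_ge.
  have : eps k < e / 8 by near: k.
  by lra.
have cF : cvg_locally_uniformly F r.
  by apply: cvg_of => k x xk; apply: le_trans (Fr k x xk) _; rewrite ler_pM2r ?pos// ler_nat.
have cF' : cvg_locally_uniformly F' r.
  apply: cvg_of => k x xk; have := Fr k x xk; have := FF' k x xk.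
  by rewrite !ler_norml => /andP[? ?] /andP[? ?]; apply/andP; split; lra.
have cr : Conv R n r.
  apply: (@Conv_lim _ _ F) => [k|x]; first by case: (average_VConv1 mh (FP k).1).
  apply/cvgrPdist_le => e e0; have := cF (euclidean_norm x) e e0.
  by apply: filterS => k /(_ x (lexx _)); rewrite distrC.
have lF : mu (F k) @[k --> \oo] --> mu r.
  by apply: (VConv1_cvg mu_V) => // k; case: (average_VConv1 mh (FP k).1).
have lF' : mu (F' k) @[k --> \oo] --> mu r.
  by apply: (VConv1_cvg mu_V) => // k; case: (average_VConv1 mhg (F'P k).1).
have E : (fun k => mu (F k)) = (fun=> mu h).
  by apply/funext => k; case: (average_VConv1 mh (FP k).1).
have E' : (fun k => mu (F' k)) = (fun=> mu (fun x => h (g *m x))).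
  by apply/funext => k; case: (average_VConv1 mhg (F'P k).1).
rewrite E in lF; rewrite E' in lF'.
transitivity (mu r).
  exact: (cvg_unique (@norm_hausdorff _ _) (cvg_cst _) lF').
exact: (cvg_unique (@norm_hausdorff _ _) lF (cvg_cst _)).
Unshelve. all: by end_near. Qed.

End Invariant.
End Transitive.
End GroupAverages.

(** * From max-affine functions to all convex functions *)

Theorem theorem3 (R : realType) (n : nat) (G : set 'M[R]_n)
    (G_subgroup : subgroup_GL G)
    (G_orthogonal : G `<=` orthogonal_group R n)
    (G_closed : closed G)
    (G_transitive : transitive_on_sphere G)
    (mu : funspace R n -> R)
    (mu_VConv1 : VConv1 R n mu)
    (mu_G : invariant_under G mu) :
  invariant_under (orthogonal_group R n) mu.
Proof.
move=> f g cf Og.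
have [F mF Ff] := maxaffine_dense cf.
have lF : mu (F k) @[k --> \oo] --> mu f.
  by apply: (VConv1_cvg mu_VConv1) => // k; exact: Conv_maxaffine.
have lFg : mu (fun x => F k (g *m x)) @[k --> \oo] --> mu (fun x => f (g *m x)).
  apply: (VConv1_cvg mu_VConv1 (F := fun k x => F k (g *m x))).
  - exact: Conv_mulmx.
  - by move=> k; apply: Conv_mulmx; exact: Conv_maxaffine.
  (* Since [g] preserves Euclidean balls, composing with it preserves locally uniform
     convergence. *)
  - move=> r e e0; have := Ff r e e0; apply: filterS => k kF x xr.
    by apply: kF; rewrite euclidean_norm_orthogonal.
have E : (fun k => mu (fun x => F k (g *m x))) = (fun k => mu (F k)).
  apply/funext => k.
  exact: (maxaffine_orthogonal_invariant G_subgroup G_orthogonal G_transitive).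
rewrite E in lFg.
exact: (cvg_unique (@norm_hausdorff _ _) lFg lF).
Qed.
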